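(* Let $H_T f_{ex} = g_{ex}$ and assume $|f_{ex}|_{TV} \leq \kappa$, with $\kappa>0$, and $f_{ex}(a_2)=f_{ex}(a_4)=0$. Consider the reconstruction of $f_{ex}$ from a noisy measurement $g\in L^2(\mathcal G)$ satisfying $\|g-g_{ex}\|_{L^2(\mathcal G)} \leq \delta$, $\delta>0$, and let $$\mathcal S = \{ f \in BV(\mathcal F): \| H_T f - g \|_{L^2(\mathcal G)} \leq \delta,\ |f|_{TV} \leq \kappa \text{ and } f \text{ vanishes at } a_2, a_4\}$$ be the set of admissible solutions. Then any algorithm that for given $\delta$, $\kappa$ and $g$ computes a solution in $\mathcal S$ is a regularization method for the reconstruction on $(a_2,a_3-\mu)$. More precisely, for all sufficiently small $\delta$ and any two admissible solutions $f_a, f_b \in \mathcal S$, $$\| \chi_\mu (f_a-f_b)\|_{L^2(\mathcal F)} \leq 2 \delta A^{-1} e^{\alpha N_\mu} + \frac{2 c}{N_\mu} B_\mu\, \kappa^{\frac{\alpha-\beta_\mu}{\alpha}} \Big( \frac{\delta}{A W_\mu}\Big)^{\frac{\beta_\mu}{\alpha}} \frac{\alpha}{(\alpha-\beta_\mu)(e^{\beta_\mu}-1)}.$$ Here $c>0$ is a constant depending only on $a_1, \dots, a_4$ and $W_\mu>0$ is a constant depending only on $\alpha, \beta_\mu, c$ and $N_\mu$.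
   Context: Let $a_1<a_2<a_3<a_4$ be real numbers, $\mathcal F=(a_2,a_4)$, $\mathcal G=(a_1,a_3)$. The truncated Hilbert transform $H_T:L^2(\mathcal F)\to L^2(\mathcal G)$ is $$(H_Tf)(x)=\frac1\pi\,\mathrm{p.v.}\!\int_{a_2}^{a_4}\frac{f(y)}{y-x}\,dy,\qquad x\in(a_1,a_3).$$ Its singular system is $(u_n,v_n,\sigma_n)_{n\in\mathbb Z}$: $u_n\in L^2(\mathcal F)$ and $v_n\in L^2(\mathcal G)$ are normalized singular functions forming orthonormal bases of the two spaces, $H_Tu_n=\sigma_nv_n$, and $\sigma_n$ is ordered decreasingly in $n\in\mathbb Z$, with $\sigma_n\to1$ as $n\to-\infty$ and $\sigma_n\to0$ as $n\to\infty$. Put $P(x)=(x-a_1)(x-a_2)(x-a_3)(x-a_4)$, $K_-=\int_{a_1}^{a_2}\frac{dx}{\sqrt{-P(x)}}$, $K_+=\int_{a_2}^{a_3}\frac{dx}{\sqrt{P(x)}}$. The indexing of the singular system is such that, for some small $\zeta>0$, $\sigma_n=2e^{-n\pi K_+/K_-}(1+O(n^{-1/2+\zeta}))$ as $n\to\infty$. A small $\mu>0$ is fixed, and $\chi_\mu$ denotes (multiplication by) the characteristic function of $(a_2,a_3-\mu)$. Set $\alpha=\pi K_+/K_-$ and $\beta_\mu=\frac{\pi}{K_-}\int_{a_3-\mu}^{a_3}\frac{dt}{\sqrt{P(t)}}$ (so $\alpha>\beta_\mu>0$). The following properties are standing assumptions: (P1) $0<\sigma_n<1$; (P2) there are $N_0\in\mathbb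 N$ and a positive real $A$ $(A<2)$ such that $\sigma_n\ge Ae^{-\alpha n}$ for $n>N_0$; (P3) there are $N_\mu\in\mathbb N$ and a positive real $B_\mu$ such that $\|\chi_\mu u_n\|_{L^2(\mathcal F)}\le B_\mu e^{-\beta_\mu n}$ for $n>N_\mu$. $N_\mu$ is selected with $N_\mu>N_0$, where $N_0$ is taken sufficiently large (depending only on the $a_i$ and $A$). $BV(\mathcal F)$ is the space of functions of bounded variation on $\mathcal F$ and $|f|_{TV}$ is the total variation of $f$ on $\mathcal F$; values at $a_2,a_4$ are boundary values (one-sided limits). An algorithm producing an estimate $f^\delta$ of $f_{ex}$ from $g$ is a regularization method for the reconstruction on $(a_2,a_3-\mu)$ if $\|\chi_\mu(f^\delta-f_{ex})\|_{L^2(\mathcal F)}\to0$ as $\delta\to0$. ''Sufficiently small $\delta$'' refers to a threshold depending on the fixed constants and $\kappa$, but not on $g,f_a,f_b$. *)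

(* Defs.v *)
From HB Require Import structures.
From mathcomp Require Export all_boot all_order all_algebra.
From mathcomp Require Export all_classical all_reals all_analysis.

Set Implicit Arguments.
Unset Strict Implicit.
Unset Printing Implicit Defensive.

Export Order.TTheory GRing.Theory Num.Theory.
Export numFieldNormedType.Exports.

Local Open Scope classical_set_scope.
Local Open Scope ring_scope.

(* Elements of L^2(D) are represented by functions R -> R whose values outside
   D are irrelevant: everything is computed on the extension by 0 [f \_ D]. *)
Section L2.
Context {R : realType}.
Implicit Types (D : set R) (f g : R -> R) (e : int -> R -> R).

Definition L2 D f : Prop := (f \_ D) \in Lfun (@lebesgue_measure R) 2%:E.

Definition L2norm D f : \bar R :=
  ('N[@lebesgue_measure R]_2%:E [EFin \o (f \_ D)])%E.

Definition L2dot D f g : R :=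
  \int[@lebesgue_measure R]_(x in D) (f x * g x).

(* sum over - N <= n <= N of <f, e_n> e_n *)
Definition L2partial_sum D e f (N : nat) : R -> R := fun x =>
  \sum_(i < N.*2.+1) L2dot D f (e (i%:Z - N%:Z)) * e (i%:Z - N%:Z) x.

Definition orthonormal_basis D e : Prop :=
  [/\ forall n, L2 D (e n),
      forall m n, L2dot D (e m) (e n) = (m == n)%:R &
      forall f, L2 D f ->
        L2norm D (fun x => f x - L2partial_sum D e f N x) @[N --> \oo]
          --> 0%E].

End L2.

Section TruncatedHilbert.
Context {R : realType}.
Implicit Types (F G : set R) (f h g : R -> R).

Definition hilbert_cutoff F f (eps x : R) : R :=
  pi^-1 * \int[@lebesgue_measure R]_(y in F `&` [set y | eps < `|y - x|])
            (f y / (y - x)).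

(* Graph of H_T : L^2(F) -> L^2(G). The function h represents H_T f when it is
   almost everywhere on G the principal value integral; working with the graph
   avoids choosing a value of H_T f on the exceptional null set. *)
Definition is_HT F G f h : Prop :=
  [/\ L2 F f, L2 G h &
      {ae @lebesgue_measure R, forall x, x \in G ->
         hilbert_cutoff F f eps x @[eps --> 0^'+] --> h x}].

(* The field [ss_adj] is H_T^* v_n = sigma_n u_n, with the Hilbert space
   adjoint unfolded. *)
Record singular_system F G (u v : int -> R -> R) (sigma : int -> R) : Prop := {
  ss_u : orthonormal_basis F u ;
  ss_v : orthonormal_basis G v ;
  ss_HT : forall n, is_HT F G (u n) (fun x => sigma n * v n x) ;
  ss_adj : forall n f h, is_HT F G f h ->
    L2dot G h (v n) = L2dot F f (fun y => sigma n * u n y) ;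
  ss_decr : forall m n : int, m <= n -> sigma n <= sigma m ;
  ss_lim1 : sigma (- n%:Z) @[n --> \oo] --> (1 : R) ;
  ss_lim0 : sigma n%:Z @[n --> \oo] --> (0 : R)
}.

End TruncatedHilbert.

Section Constants.
Context {R : realType}.
Implicit Types (mu x : R).

Definition quartic (a1 a2 a3 a4 : R) x : R :=
  (x - a1) * (x - a2) * (x - a3) * (x - a4).

Definition Kminus (a1 a2 a3 a4 : R) : R :=
  \int[@lebesgue_measure R]_(x in `]a1, a2[)
    (Num.sqrt (- quartic a1 a2 a3 a4 x))^-1.

Definition Kplus (a1 a2 a3 a4 : R) : R :=
  \int[@lebesgue_measure R]_(x in `]a2, a3[)
    (Num.sqrt (quartic a1 a2 a3 a4 x))^-1.

Definition alpha (a1 a2 a3 a4 : R) : R :=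
  pi * Kplus a1 a2 a3 a4 / Kminus a1 a2 a3 a4.

Definition beta (a1 a2 a3 a4 : R) mu : R :=
  pi / Kminus a1 a2 a3 a4 *
  \int[@lebesgue_measure R]_(t in `]a3 - mu, a3[)
    (Num.sqrt (quartic a1 a2 a3 a4 t))^-1.

(* sigma_n = 2 e^(- n al) (1 + O(n^(- 1/2 + zeta))) as n -> +oo *)
Definition sigma_asymptotics (al : R) (sigma : int -> R) : Prop :=
  exists2 zeta : R, 0 < zeta < 2^-1 &
    exists C : R, \forall n \near \oo,
      `|sigma n%:Z / (2 * expR (- (n%:R * al))) - 1|
        <= C * n%:R `^ (- 2^-1 + zeta).

End Constants.

Section AdmissibleSolutions.
Context {R : realType}.
Implicit Types (a b p q kappa delta : R) (F G : set R) (f g h : R -> R).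

(* Total variation on the open interval (a, b): the library's
   [total_variation] is the one on a closed interval. *)
Definition TV_oo a b f : \bar R :=
  ereal_sup [set total_variation pq.1 pq.2 f |
             pq in [set pq : R * R | [/\ a < pq.1, pq.1 <= pq.2 & pq.2 < b]]].

Definition BV_oo a b f : Prop := (TV_oo a b f < +oo)%E.

Definition vanishes_at_ends a b f : Prop :=
  f x @[x --> a^'+] --> (0 : R) /\ f x @[x --> b^'-] --> (0 : R).

Variables (a1 a2 a3 a4 : R).

(* f_ex and g_ex = H_T f_ex *)
Definition exact_data kappa f g : Prop :=
  [/\ is_HT `]a2, a4[ `]a1, a3[ f g, (TV_oo a2 a4 f <= kappa%:E)%E &
      vanishes_at_ends a2 a4 f].

Definition noisy_data delta g_ex g : Prop :=
  L2 `]a1, a3[ g /\ (L2norm `]a1, a3[ (g \- g_ex)%R <= delta%:E)%E.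

Definition admissible delta kappa g : set (R -> R) := [set f |
  [/\ BV_oo a2 a4 f,
      exists2 h, is_HT `]a2, a4[ `]a1, a3[ f h &
                 (L2norm `]a1, a3[ (h \- g)%R <= delta%:E)%E,
      (TV_oo a2 a4 f <= kappa%:E)%E &
      vanishes_at_ends a2 a4 f]].

Definition chi_norm mu f : \bar R :=
  L2norm `]a2, a4[ (\1_(`]a2, a3 - mu[%classic : set R) \* f).

(* The algorithm takes delta, kappa and g. It is only required to succeed on
   inputs for which an admissible solution exists. *)
Definition computes_admissible kappa
    (algo : R -> R -> (R -> R) -> (R -> R)) : Prop :=
  forall delta g, 0 < delta -> L2 `]a1, a3[ g ->
    admissible delta kappa g !=set0 ->
    admissible delta kappa g (algo delta kappa g).

(* Convergence as delta -> 0, uniformly in the noisy data at level delta *)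
Definition regularization_method mu kappa
    (algo : R -> R -> (R -> R) -> (R -> R)) : Prop :=
  forall f_ex g_ex, exact_data kappa f_ex g_ex ->
  forall eps : R, 0 < eps -> \forall delta \near 0^'+,
    forall g, noisy_data delta g_ex g ->
      (chi_norm mu (algo delta kappa g \- f_ex)%R <= eps%:E)%E.

End AdmissibleSolutions.

(* Main.v *)
Require Import Defs.
From mathcomp Require Import ring lra measurable_realfun.

Set Implicit Arguments.
Unset Strict Implicit.
Unset Printing Implicit Defensive.

(* Let f = f_a - f_b, so that |H_T f| <= 2 delta and, since f vanishes at a_2
   and has total variation at most 2 kappa, |f| <= 2 kappa c in L^2, where
   c = sqrt(a_4 - a_2).  The modes n <= N_mu contribute at most
   2 delta / sigma_(N_mu), by Bessel's inequality for the v_n.  For n > N_mu the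
   coefficient <f, u_n> is at most min(2 (delta / A) e^(alpha n), 2 kappa c) and
   the localised mode has norm at most B e^(- beta n); the sum of the products is
   a constant times (delta / A)^(beta / alpha) (kappa c)^(1 - beta / alpha).
   The trivial bound |<f, u_n>| <= |f| suffices here because, for fixed N_mu, the
   factor 1 / N_mu is a constant, which W_mu absorbs.
   The inequalities 0 < beta < alpha follow from alpha > 0, which is forced by
   A e^(- alpha n) <= sigma_n -> 0. *)

Local Open Scope classical_set_scope.
Local Open Scope ring_scope.

(** * Linear structure, inner product and norm of L^2(D) *)

Section L2Theory.
Context {R : realType}.
Variable D : set R.
Hypothesis mD : measurable D.
Implicit Types (f g h : R -> R) (e : int -> R -> R) (c : int -> R).

Local Notation mu := (@lebesgue_measure R).

Lemma restrictE f x : (f \_ D) x = if x \in D then f x else 0.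
Proof. by []. Qed.

Let le1_2 : (1 <= 2%:E :> \bar R)%E.
Proof. by rewrite lee_fin ler1n. Qed.

Lemma L2Dl a f g : L2 D f -> L2 D g -> L2 D (fun x => a * f x + g x).
Proof.
move=> Lf Lg; rewrite /L2.
have -> : (fun x => a * f x + g x) \_ D = a *: (f \_ D) + (g \_ D).
  apply/funext => x; rewrite /GRing.add/= /GRing.scale/= !restrictE.
  by case: ifP => // _; rewrite /GRing.scale/= mulr0 addr0.
exact: ((@Lfun_submod_closed _ _ _ mu 2%:E le1_2).2 a _ _ Lf Lg).
Qed.

Lemma L20 : L2 D (fun=> 0).
Proof.
rewrite /L2; have -> : (fun=> 0) \_ D = 0 :> (R -> R).
  by apply/funext => x; rewrite restrictE; case: ifP.
exact: (@Lfun_submod_closed _ _ _ mu 2%:E le1_2).1.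
Qed.

Lemma L2Z a f : L2 D f -> L2 D (fun x => a * f x).
Proof.
by move=> Lf; have := L2Dl a Lf L20; under eq_fun do rewrite addr0.
Qed.

Lemma L2D f g : L2 D f -> L2 D g -> L2 D (fun x => f x + g x).
Proof.
by move=> Lf Lg; have := L2Dl 1 Lf Lg; under eq_fun do rewrite mul1r.
Qed.

Lemma L2B f g : L2 D f -> L2 D g -> L2 D (fun x => f x - g x).
Proof.
move=> Lf Lg; have := L2Dl (- 1) Lg Lf.
by under eq_fun do rewrite mulN1r addrC.
Qed.

Lemma L2_sum (s : seq int) c e : (forall n, L2 D (e n)) ->
  L2 D (fun x => \sum_(n <- s) c n * e n x).
Proof.
move=> Le; elim: s => [|n s IH].
  by under eq_fun do rewrite big_nil; exact: L20.
by under eq_fun do rewrite big_cons; exact: L2Dl.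
Qed.

Lemma L2_integrableM f g : L2 D f -> L2 D g ->
  mu.-integrable D (EFin \o (fun x => f x * g x)).
Proof.
move=> Lf Lg; apply/integrable_mkcond => //.
have -> : (EFin \o (fun x => f x * g x)) \_ D = EFin \o ((f \_ D) \* (g \_ D)).
  rewrite restrict_EFin; congr (_ \o _); apply/funext => x /=.
  by rewrite !restrictE; case: ifP; rewrite ?mulr0.
exact/Lfun1_integrable/Lfun2_mul_Lfun1.
Qed.

Lemma L2dotC f g : L2dot D f g = L2dot D g f.
Proof. by rewrite /L2dot; under eq_Rintegral do rewrite mulrC. Qed.

Lemma L2dotDl a f g h : L2 D f -> L2 D g -> L2 D h ->
  L2dot D (fun x => a * f x + g x) h = a * L2dot D f h + L2dot D g h.
Proof.
move=> Lf Lg Lh; rewrite /L2dot.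
under eq_Rintegral do rewrite mulrDl -mulrA.
have Lfh := L2_integrableM (L2Z a Lf) Lh.
rewrite RintegralD//.
- by rewrite RintegralZl//; exact: L2_integrableM.
- by apply: eq_integrable Lfh => // x _ /=; rewrite mulrA.
- exact: L2_integrableM.
Qed.

Lemma L2dotBl f g h : L2 D f -> L2 D g -> L2 D h ->
  L2dot D (fun x => f x - g x) h = L2dot D f h - L2dot D g h.
Proof.
move=> Lf Lg Lh; rewrite addrC -mulN1r -L2dotDl//.
by congr L2dot; apply/funext => x; rewrite mulN1r addrC.
Qed.

Lemma L2dot_suml (s : seq int) c e h : (forall n, L2 D (e n)) -> L2 D h ->
  L2dot D (fun x => \sum_(n <- s) c n * e n x) h =
  \sum_(n <- s) c n * L2dot D (e n) h.
Proof.
move=> Le Lh; elim: s => [|n s IH].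
  rewrite big_nil /L2dot; under eq_Rintegral do rewrite big_nil mul0r.
  by rewrite Rintegral_cst// mul0r.
rewrite big_cons -IH -L2dotDl//; last exact: L2_sum.
by congr L2dot; apply/funext => x; rewrite big_cons.
Qed.

Lemma L2dotxx_ge0 f : 0 <= L2dot D f f.
Proof. by apply: Rintegral_ge0 => x _; rewrite -expr2 sqr_ge0. Qed.

(** On L^2 the extended-real norm is finite, so norm estimates reduce to real inequalities between
    inner products. *)
Lemma L2normE f : L2 D f -> L2norm D f = (Num.sqrt (L2dot D f f))%:E.
Proof.
move=> Lf; rewrite /L2norm unlock -powR12_sqrt ?L2dotxx_ge0// -poweR_EFin.
congr (_ `^ _)%E.
rewrite /L2dot Rintegral_mkcond /Rintegral fineK; last first.
  apply: integrable_fin_num => //.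
  apply: eq_integrable (Lfun2_integrable_sqr Lf) => // x _ /=.
  by rewrite !restrictE; case: ifP; rewrite ?expr0n.
apply: eq_integral => x _ /=; rewrite powR_mulrn// real_normK ?num_real//.
by rewrite !restrictE; case: ifP; rewrite ?expr0n.
Qed.

Lemma le_L2norm f g : L2 D f -> L2 D g ->
  (forall x, D x -> `|f x| <= `|g x|) -> (L2norm D f <= L2norm D g)%E.
Proof.
move=> Lf Lg fg; rewrite !L2normE// lee_fin ler_wsqrtr//.
apply: le_Rintegral => //; [exact: L2_integrableM..|] => x /fg.
by rewrite -!expr2 -ler_sqr ?nnegrE// !real_normK ?num_real.
Qed.

Lemma L2normD f g : L2 D f -> L2 D g ->
  (L2norm D (fun x => f x + g x)%R <= L2norm D f + L2norm D g)%E.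
Proof.
move=> Lf Lg; rewrite /L2norm.
have -> : (fun x => f x + g x) \_ D = ((f \_ D) \+ (g \_ D)).
  by apply/funext => x /=; rewrite !restrictE; case: ifP; rewrite ?addr0.
move/andP : Lf => [/set_mem/= mf _]; move/andP : Lg => [/set_mem/= mg _].
exact: eminkowski le1_2.
Qed.

Lemma L2normZ a f : L2 D f ->
  L2norm D (fun x => a * f x)%R = (`|a|%:E * L2norm D f)%E.
Proof.
move=> Lf; rewrite !L2normE//; last exact: L2Z.
rewrite -EFinM -sqrtr_sqr -sqrtrM ?sqr_ge0//; congr (Num.sqrt _)%:E.
rewrite /L2dot; under eq_Rintegral do rewrite mulrACA.
by rewrite RintegralZl//; exact: L2_integrableM.
Qed.

Lemma L2normC f g : L2norm D (f \- g)%R = L2norm D (g \- f)%R.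
Proof.
rewrite /L2norm -[LHS]oppe_Lnorm; apply: eq_Lnorm => x /=.
by rewrite !restrictE; case: ifP => _ /=; rewrite ?oppr0// opprB.
Qed.

Lemma L2_dominated f g : measurable_fun [set: R] (f \_ D) -> L2 D g ->
  (forall x, D x -> `|f x| <= `|g x|) -> L2 D f.
Proof.
move=> mf /andP[/set_mem/= mg /set_mem/= fg] le_fg.
apply/andP; split; apply/mem_set => //=.
apply: le_lt_trans fg; rewrite unlock; apply: gt0_ler_poweR => //.
- by rewrite in_itv/= leey integral_ge0.
- by rewrite in_itv/= leey integral_ge0.
- apply: ge0_le_integral => //.
  + by move=> x _; exact: poweR_ge0.
  + apply/measurable_EFinP/(measurableT_comp (measurable_powR _)) => //.
    exact: measurableT_comp.
  + apply/measurable_EFinP/(measurableT_comp (measurable_powR _)) => //.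
    exact: measurableT_comp.
  move=> x _; rewrite lee_fin ge0_ler_powR ?nnegrE//= !restrictE.
  by case: ifPn => // /set_mem; exact: le_fg.
Qed.

End L2Theory.

(** * Finite orthonormal sums and Bessel's inequality *)

Section Orthonormal.
Context {R : realType}.
Variables (D : set R) (e : int -> R -> R).
Hypotheses (mD : measurable D) (Le : forall n, L2 D (e n)).
Hypothesis e_orth : forall m n, L2dot D (e m) (e n) = (m == n)%:R.
Implicit Types (s : seq int) (c : int -> R).

Lemma L2dot_sum_orthonormal s c m : uniq s ->
  L2dot D (fun x => \sum_(n <- s) c n * e n x) (e m) = c m *+ (m \in s).
Proof.
move=> us; rewrite L2dot_suml//.
under eq_bigr do rewrite e_orth.
elim: s us => [|n s IH] /=; first by rewrite big_nil.
move=> /andP[ns us]; rewrite big_cons IH// in_cons.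
have [->|_] := eqVneq m n; last by rewrite mulr0 add0r.
by rewrite mulr1 (negbTE ns) mulr0n addr0.
Qed.

Lemma L2dot_sum_sum s c : uniq s ->
  L2dot D (fun x => \sum_(n <- s) c n * e n x)
          (fun x => \sum_(n <- s) c n * e n x) = \sum_(n <- s) c n ^+ 2.
Proof.
move=> us; rewrite L2dot_suml//; last exact: L2_sum.
rewrite [LHS]big_seq [RHS]big_seq; apply: eq_bigr => n ns.
by rewrite L2dotC L2dot_sum_orthonormal// ns mulr1n expr2.
Qed.

(** Expand <h - p, h - p> >= 0 for the projection p of h on the span of the chosen modes: <h, p> and
    <p, p> both equal the sum of squares. *)
Lemma bessel s h : uniq s -> L2 D h ->
  \sum_(n <- s) L2dot D h (e n) ^+ 2 <= L2dot D h h.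
Proof.
move=> us Lh; set c := fun n => L2dot D h (e n).
pose p x := \sum_(n <- s) c n * e n x.
have Lp : L2 D p by exact: L2_sum.
have hp : L2dot D h p = \sum_(n <- s) c n ^+ 2.
  by rewrite L2dotC L2dot_suml//; apply: eq_bigr => n _; rewrite L2dotC expr2.
have := L2dotxx_ge0 D (fun x => h x - p x).
rewrite L2dotBl//; last exact: L2B.
rewrite !(L2dotC _ _ (fun x => h x - p x)) !L2dotBl//.
by rewrite (L2dotC _ p h) hp L2dot_sum_sum// subrr subr0 subr_ge0.
Qed.

(** Bessel's inequality for a single mode, in the role of Cauchy-Schwarz. *)
Lemma normr_L2dot_le h n : L2 D h -> (`|L2dot D h (e n)|%:E <= L2norm D h)%E.
Proof.
move=> Lh; rewrite L2normE// lee_fin -sqrtr_sqr ler_wsqrtr//.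
by have := @bessel [:: n] h isT Lh; rewrite big_seq1.
Qed.

End Orthonormal.

(** * Geometric sums cut at a threshold *)

Section ThresholdedSums.
Context {R : realType}.
Implicit Types (al be X Y t : R).

(** The terms kept form an initial segment of a geometric progression whose last term is at most
    [Q]; read backwards from that term they decay with ratio [r]. *)
Lemma thresholded_sum_increasing (z : nat -> R) (r Q : R) (K : nat) :
  0 <= r < 1 -> 0 <= Q -> (forall i, 0 <= z i) ->
  (forall i, z i = r * z i.+1) ->
  \sum_(i < K) (if z i <= Q then z i else 0) <= Q / (1 - r).
Proof.
move=> /andP[r0 r1] Q0 z0 zS; have r1' : 0 < 1 - r by rewrite subr_gt0.
(* The bound is strengthened for the induction: [r * z K] is the last summand when [K] is positive,
   and the minimum covers the terms below and above the threshold at once. *)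
suff : \sum_(i < K) (if z i <= Q then z i else 0)
    <= Num.min (r * z K) Q / (1 - r).
  move/le_trans; apply; rewrite ler_wpM2r ?invr_ge0 ?(ltW r1')//.
  by rewrite ge_min lexx orbT.
elim: K => [|K IH].
  by rewrite big_ord0 divr_ge0 ?(ltW r1')// le_min mulr_ge0.
rewrite big_ord_recr/= -zS; case: ifPn => [zQ|].
  rewrite (min_idPl zQ) -lerBrDr (le_trans IH)//.
  rewrite ler_pdivrMr// mulrBl divfK ?gt_eqF// mulrBr mulr1 opprB.
  by rewrite addrCA addrN addr0 mulrC ge_min lexx.
rewrite -ltNge addr0 => /ltW zQ; rewrite (min_idPr zQ) (le_trans IH)//.
by rewrite ler_wpM2r ?invr_ge0 ?(ltW r1')// ge_min lexx orbT.
Qed.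

(** Mirror image of the increasing case: the terms kept start at the first one below [Q]. The
    induction removes the first term, so it runs over all sequences [z] and passes to the shifted
    one. *)
Lemma thresholded_sum_decreasing (z : nat -> R) (r Q : R) (K : nat) :
  0 <= r < 1 -> 0 <= Q -> (forall i, 0 <= z i) ->
  (forall i, z i.+1 = r * z i) ->
  \sum_(i < K) (if z i <= Q then z i else 0) <= Q / (1 - r).
Proof.
move=> /andP[r0 r1] Q0; have r1' : 0 < 1 - r by rewrite subr_gt0.
move=> z0 zS.
suff : \sum_(i < K) (if z i <= Q then z i else 0)
    <= Num.min (z 0%N) Q / (1 - r).
  move/le_trans; apply; rewrite ler_wpM2r ?invr_ge0 ?(ltW r1')//.
  by rewrite ge_min lexx orbT.
elim: K z z0 zS => [|K IH] z z0 zS.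
  by rewrite big_ord0 divr_ge0 ?(ltW r1')// le_min z0.
have {IH} := IH (z \o S) (fun i => z0 _) (fun i => zS _).
rewrite big_ord_recl/= => IH; case: ifPn => [zQ|].
  rewrite (min_idPl zQ) -lerBrDl (le_trans IH)//.
  rewrite ler_pdivrMr// mulrBl divfK ?gt_eqF// mulrBr mulr1 opprB.
  by rewrite addrCA addrN addr0 mulrC -zS ge_min lexx.
rewrite -ltNge add0r => /ltW zQ; rewrite (min_idPr zQ) (le_trans IH)//.
by rewrite ler_wpM2r ?invr_ge0 ?(ltW r1')// ge_min lexx orbT.
Qed.

(* With [s := i%:R - t] the summand is the minimum of the two exponentials
   [expR (X + (al - be) * s)] and [expR (Y - be * s)], and both equal the common
   threshold [Q] at the crossing point [X + al * s = Y]: the part of the sum on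
   either side of it is a geometric series below [Q]. *)
Lemma sum_min_expR_le al be X Y t (K : nat) : 0 < be -> be < al ->
  \sum_(i < K) Num.min (expR (X + al * (i%:R - t))) (expR Y)
               * expR (- (be * (i%:R - t)))
  <= expR (be / al * X + (al - be) / al * Y)
     * ((1 - expR (- (al - be)))^-1 + (1 - expR (- be))^-1).
Proof.
move=> be0 beal; set Q := expR (_ + _).
have al0 : 0 < al by exact: lt_trans beal.
have ratio (b : R) : 0 < b -> 0 <= expR (- b) < 1.
  by move=> b0; rewrite expR_ge0 -expR0 ltr_expR oppr_lt0.
pose z (i : nat) := expR (X + (al - be) * (i%:R - t)).
pose w (i : nat) := expR (Y - be * (i%:R - t)).
have zsum : \sum_(i < K) (if z i <= Q then z i else 0)
    <= Q / (1 - expR (- (al - be))).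
  apply: thresholded_sum_increasing => [||i|i]; try exact: expR_ge0.
    by apply: ratio; rewrite subr_gt0.
  by rewrite -expRD; congr expR; rewrite -natr1; ring.
have wsum : \sum_(i < K) (if w i <= Q then w i else 0) <= Q / (1 - expR (- be)).
  apply: thresholded_sum_decreasing => [||i|i]; try exact: expR_ge0.
    exact: ratio.
  by rewrite -expRD; congr expR; rewrite -natr1; ring.
rewrite mulrDr; apply: le_trans (lerD zsum wsum).
rewrite -big_split/=; apply: ler_sum => i _; set s := i%:R - t.
have [XY|YX] := leP (X + al * s) Y.
- have zQ : z i <= Q.
    rewrite ler_expR -/s -subr_ge0.
    have -> : be / al * X + (al - be) / al * Y - (X + (al - be) * s)
        = (al - be) / al * (Y - (X + al * s)) by field; rewrite gt_eqF.
    by rewrite mulr_ge0 ?subr_ge0// divr_ge0 ?subr_ge0 ?(ltW beal) ?(ltW al0).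
  rewrite zQ -[leLHS]addr0 lerD//; last by case: ifP; rewrite ?expR_ge0.
  rewrite (min_idPl _) ?ler_expR// -expRD ler_expR -/s.
  by rewrite le_eqVlt; apply/orP; left; apply/eqP; ring.
- have wQ : w i <= Q.
    rewrite ler_expR -/s -subr_ge0.
    have -> : be / al * X + (al - be) / al * Y - (Y - be * s)
        = be / al * (X + al * s - Y) by field; rewrite gt_eqF.
    by rewrite mulr_ge0 ?subr_ge0 ?(ltW YX)// divr_ge0 ?(ltW be0) ?(ltW al0).
  rewrite wQ -[leLHS]add0r lerD//; first by case: ifP; rewrite ?expR_ge0.
  by rewrite (min_idPr _) ?ler_expR ?(ltW YX)// -expRD.
Qed.

End ThresholdedSums.

(** * Pointwise bound from the total variation *)

Section TotalVariation.
Context {R : realType}.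

(** For p between a and x, |f x - f p| is at most the variation on [p, x]; let p tend to a, where f
    tends to 0. *)
Lemma normr_le_TV_oo (a b k x : R) (f : R -> R) :
  (TV_oo a b f <= k%:E)%E -> f p @[p --> a^'+] --> (0 : R) ->
  a < x -> x < b -> `|f x| <= k.
Proof.
move=> TVf fa ax xb; rewrite -[f x]subr0.
have cf : `|f x - f p| @[p --> a^'+] --> `|f x - 0|.
  by apply: cvg_norm; apply: cvgB => //; exact: cvg_cst.
apply: (cvgr_to_le cf); near=> p.
rewrite -lee_fin (le_trans _ TVf)//.
have px : p <= x by apply: ltW; near: p; exact: nbhs_right_lt.
have ap : a < p by near: p; exact: nbhs_right_gt.
apply: le_trans (total_variation_ge f px) _.
by apply: ereal_sup_ubound; exists (p, x).
Unshelve. all: by end_near. Qed.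

End TotalVariation.

(** * The elliptic integrals and the inequalities 0 < beta < alpha *)

Section PositiveIntegrals.
Context {R : realType}.
Local Notation mu := (@lebesgue_measure R).

(** A zero integral would make the nonnegative [f] vanish almost everywhere on [D]; as [f] has no
    zero there, [D] would be a null set. *)
Lemma Rintegral_gt0 (D : set R) (f : R -> R) : measurable D -> (0 < mu D)%E ->
  mu.-integrable D (EFin \o f) -> (forall x, D x -> 0 < f x) ->
  0 < \int[mu]_(x in D) f x.
Proof.
move=> mD D0 intf f0; rewrite lt_neqAle Rintegral_ge0 ?andbT; last first.
  by move=> x /f0/ltW.
apply/eqP => /esym If0.
have : (\int[mu]_(x in D) `|(EFin \o f) x| = 0)%E.
  rewrite -[RHS](congr1 EFin If0) /Rintegral fineK.
    by apply: eq_integral => x /set_mem/f0 fx; rewrite gee0_abs ?lee_fin ?ltW.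
  exact: integrable_fin_num.
move=> /(ae_eq_integral_abs mu mD (measurable_int mu intf)).1 [N [mN N0 subN]].
have DN : D `<=` N.
  move=> x Dx; apply: subN => /= /(_ Dx) [] fx.
  by move: (f0 _ Dx); rewrite fx ltxx.
have : (mu D <= mu N)%E by apply: le_measure; rewrite ?inE.
by move: N0 => /= ->; rewrite leNgt D0.
Qed.

Variables (a1 a2 a3 a4 : R).
Hypotheses (a12 : a1 < a2) (a23 : a2 < a3) (a34 : a3 < a4).
Local Notation P := (quartic a1 a2 a3 a4).

Lemma quartic_gt0 x : a2 < x -> x < a3 -> 0 < P x.
Proof.
move=> x2 x3; rewrite /quartic -mulrA pmulr_rgt0.
  by rewrite nmulr_lgt0 ?subr_lt0// (lt_trans x3).
by rewrite mulr_gt0// subr_gt0// (lt_trans a12).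
Qed.

Lemma measurable_invr_sqrt_quartic (D : set R) :
  D `<=` `]a2, a3[ -> measurable D ->
  measurable_fun D (fun x => (Num.sqrt (P x))^-1).
Proof.
move=> Da mD.
(* Where [P] is positive, the inverse square root is the power -1/2, whose measurability is known on
   the whole line. *)
apply: (@eq_measurable_fun _ _ _ _ _ (fun x => P x `^ (- 2^-1))).
  move=> x /set_mem/Da.
  rewrite /= in_itv/= => /andP[x2 x3].
  by rewrite powRN powR12_sqrt// ltW// quartic_gt0.
apply: measurable_funTS; apply: (measurableT_comp (measurable_powR _)) => //.
by rewrite /quartic; do !apply: measurable_funM => //; apply: measurable_funB.
Qed.

Lemma alpha_beta_bounds m : 0 < alpha a1 a2 a3 a4 -> 0 < m -> m < a3 - a2 ->
  0 < beta a1 a2 a3 a4 m /\ beta a1 a2 a3 a4 m < alpha a1 a2 a3 a4.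
Proof.
set phi := fun x => (Num.sqrt (P x))^-1.
have phi0 x : 0 <= phi x by rewrite invr_ge0 sqrtr_ge0.
move=> al0 m0 ma.
have Km0 : 0 <= Kminus a1 a2 a3 a4.
  by apply: Rintegral_ge0 => x _; rewrite invr_ge0 sqrtr_ge0.
(* Since the inverse of 0 is 0 by convention, [Kminus] = 0 would give [alpha] = 0, just as [Kplus] =
   0 would. *)
have [Kp0 Km_gt0] : Kplus a1 a2 a3 a4 != 0 /\ 0 < Kminus a1 a2 a3 a4.
  rewrite lt_neqAle Km0 andbT; split; apply/eqP => K0; move: al0.
    by rewrite /alpha K0 mulr0 mul0r ltxx.
  by rewrite /alpha -K0 invr0 mulr0 ltxx.
(* [Kplus] is the [fine] part of an extended integral, so [Kplus != 0] rules
   out the value [+oo]. *)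
have phi_int : mu.-integrable `]a2, a3[ (EFin \o phi).
  apply/integrableP; split.
    by apply/measurable_EFinP; exact: measurable_invr_sqrt_quartic.
  under eq_integral do rewrite gee0_abs ?lee_fin//.
  rewrite ltey; apply: contra Kp0 => /eqP Kpoo.
  by rewrite /Kplus /Rintegral Kpoo.
have phi_gt0 x : a2 < x -> x < a3 -> 0 < phi x.
  by move=> ? ?; rewrite invr_gt0 sqrtr_gt0 quartic_gt0.
have split_Kp : Kplus a1 a2 a3 a4 - \int[mu]_(x in `]a2, a3 - m]) phi x =
    \int[mu]_(x in `]a3 - m, a3[) phi x.
  by apply: Rintegral_itvB => //; rewrite bnd_simp; lra.
have piK : 0 < pi / Kminus a1 a2 a3 a4 by rewrite divr_gt0// pi_gt0.
split.
  rewrite /beta mulr_gt0//; apply: Rintegral_gt0 => //.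
  - by rewrite lebesgue_measure_itv/= lte_fin ifT ?lte_fin; lra.
  - apply: integrableS phi_int => //; apply: subset_itv => //=.
    by rewrite bnd_simp; lra.
  - by move=> x; rewrite /= in_itv/= => /andP[? ?]; apply: phi_gt0 => //; lra.
(* Up to the factor [pi / Kminus], alpha - beta is the integral over []a2, a3 - m]], which has
   positive length. *)
rewrite /alpha /beta [ltRHS]mulrAC (ltr_pM2l piK) -split_Kp gtrBl.
apply: Rintegral_gt0 => //.
- by rewrite lebesgue_measure_itv/= lte_fin ifT ?lte_fin; lra.
- apply: integrableS phi_int => //; apply: subset_itv => //=.
  by rewrite bnd_simp; lra.
- by move=> x; rewrite /= in_itv/= => /andP[? ?]; apply: phi_gt0 => //; lra.
Qed.

End PositiveIntegrals.

(** If [al] were nonpositive, the lower bound would be at least [A] for all large n, which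
    contradicts the limit 0. *)
Lemma rate_gt0 {R : realType} (A al : R) (s : R^nat) (N : nat) : 0 < A ->
  s n @[n --> \oo] --> (0 : R) ->
  (forall n, (N < n)%N -> A * expR (- (al * n%:R)) <= s n) -> 0 < al.
Proof.
move=> A0 s0 As; rewrite ltNge; apply/negP => al0.
have : A <= 0.
  apply: (cvgr_to_ge s0); exists N.+1 => // n /= Nn.
  apply: le_trans (As _ Nn); rewrite ler_peMr ?(ltW A0)//.
  by rewrite -expR0 ler_expR oppr_ge0 mulr_le0_ge0.
by rewrite leNgt A0.
Qed.

(** * Cutting off by a characteristic function and splitting a basis expansion *)

Section Restriction.
Context {R : realType}.
Variables (D E : set R).
Hypotheses (mD : measurable D) (mE : measurable E).
Implicit Types f g : R -> R.
Local Notation cut f := (\1_E \* f : R -> R).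

Lemma cut_le f x : `|(cut f) x| <= `|f x|.
Proof.
by rewrite /= indicE; case: (x \in E); rewrite ?mul1r// mul0r normr0 normr_ge0.
Qed.

Lemma L2_cut f : L2 D f -> L2 D (cut f).
Proof.
move=> Lf; apply: (L2_dominated _ Lf) => [|x _]; last exact: cut_le.
have -> : (cut f) \_ D = \1_E \* (f \_ D).
  by apply/funext => x /=; rewrite !restrictE; case: ifP; rewrite ?mulr0.
move/andP: Lf => [/set_mem/= mf _].
by apply: measurable_funM.
Qed.

Lemma L2norm_cut_le f : L2 D f -> (L2norm D (cut f) <= L2norm D f)%E.
Proof.
by move=> Lf; apply: le_L2norm => //; [exact: L2_cut|move=> x _; exact: cut_le].
Qed.

Lemma L2norm_cutD f g : L2 D f -> L2 D g ->
  (L2norm D (cut (fun x => f x + g x)%R) <=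
   L2norm D (cut f) + L2norm D (cut g))%E.
Proof.
move=> Lf Lg; rewrite -[leLHS]/(L2norm D (fun x => \1_E x * (f x + g x))%R).
under eq_fun do rewrite mulrDr.
by apply: (L2normD (f := cut f) (g := cut g)); exact: L2_cut.
Qed.

Lemma L2norm_cut_sum (s : seq int) (P : pred int) (c : int -> R)
    (e : int -> R -> R) : (forall n, L2 D (e n)) ->
  (L2norm D (cut (fun x => \sum_(n <- s | P n) c n * e n x)%R) <=
   \sum_(n <- s | P n) `|c n|%:E * L2norm D (cut (e n)))%E.
Proof.
move=> Le.
under [X in L2norm D (cut X)]eq_fun do rewrite -big_filter.
rewrite -big_filter; elim: {s P}[seq n <- s | P n] => [|n s IH].
  rewrite big_nil L2normE; last first.
    by apply: L2_cut => //; under eq_fun do rewrite big_nil; exact: L20.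
  rewrite (_ : L2dot _ _ _ = 0) ?sqrtr0// /L2dot.
  under eq_Rintegral do rewrite /= big_nil mulr0 mul0r.
  by rewrite Rintegral_cst// mul0r.
rewrite big_cons; under [X in L2norm D (cut X)]eq_fun do rewrite big_cons.
apply: le_trans (L2norm_cutD _ _) _ => //; [exact: L2Z|exact: L2_sum|].
rewrite leeD// -(L2normZ mD _ (L2_cut (Le n))).
rewrite le_eqVlt; apply/orP; left; apply/eqP; congr L2norm.
by apply/funext => x /=; rewrite mulrCA.
Qed.

(** Modes up to [n0] are estimated jointly: the cut does not increase the norm, and orthonormality
    gives [S]. Modes beyond [n0] are estimated one by one with the triangle inequality, where [b]
    records the smallness of each cut mode. *)
Lemma L2norm_cut_basis_le (e : int -> R -> R) (f : R -> R) (n0 : int)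
    (b : int -> R) (S T : R) :
  orthonormal_basis D e -> L2 D f -> 0 <= S ->
  (forall n, n0 < n -> (L2norm D (cut (e n)) <= (b n)%:E)%E) ->
  (forall s : seq int, uniq s -> (forall n, n \in s -> n <= n0) ->
     \sum_(n <- s) L2dot D f (e n) ^+ 2 <= S ^+ 2) ->
  (forall N : nat, \sum_(i < N.*2.+1 | n0 < i%:Z - N%:Z)
     `|L2dot D f (e (i%:Z - N%:Z))| * b (i%:Z - N%:Z) <= T) ->
  (L2norm D (cut f) <= (S + T)%:E)%E.
Proof.
move=> [Le e_orth e_tot] Lf S0 eb lowS highT; set c := fun n => L2dot D f (e n).
pose err N := L2norm D (fun x => f x - L2partial_sum D e f N x).
(* For each N the remainder of the expansion enters as an error term, which vanishes in the limit by
   completeness of the basis. *)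
suff errP N : (L2norm D (cut f) <= err N + (S + T)%:E)%E.
  have errD : (err N + (S + T)%:E)%E @[N --> \oo] --> (0 + (S + T)%:E)%E.
    by apply: cvgeD => //; [exact: e_tot|exact: cvg_cst].
  by rewrite -[leRHS]add0e; apply: (cvge_to_ge errD); exact: nearW.
(* The indices from -N to N become a duplicate-free list of integers, which can be split at [n0]. *)
pose s := [seq i%:Z - N%:Z | i <- iota 0 N.*2.+1].
have us : uniq s.
  by rewrite map_inj_uniq ?iota_uniq// => i j /addIr [].
have sumE (V : nmodType) (F : int -> V) (P : pred int) :
    \sum_(i < N.*2.+1 | P (i%:Z - N%:Z)) F (i%:Z - N%:Z)
    = \sum_(n <- s | P n) F n.
  rewrite big_map -(big_mkord (fun i => P (i%:Z - N%:Z))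
    (fun i => F (i%:Z - N%:Z))).
  by rewrite /index_iota subn0.
pose low x := \sum_(n <- s | n <= n0) c n * e n x.
pose high x := \sum_(n <- s | ~~ (n <= n0)) c n * e n x.
have Lsum (P : pred int) : L2 D (fun x => \sum_(n <- s | P n) c n * e n x).
  by under eq_fun do rewrite -big_filter; exact: L2_sum.
have partE x : L2partial_sum D e f N x = low x + high x.
  rewrite /L2partial_sum (sumE _ (fun n => c n * e n x) predT).
  by rewrite (bigID (fun n => n <= n0)).
have Lpart : L2 D (L2partial_sum D e f N).
  by rewrite (funext partE); apply: L2D; exact: Lsum.
have Lerr : L2 D (fun x => f x - L2partial_sum D e f N x) by exact: L2B.
have fE : f = (fun x => (f x - L2partial_sum D e f N x) + (low x + high x)).
  by apply/funext => x; rewrite -partE subrK.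
rewrite {1}fE; apply: le_trans (L2norm_cutD _ _) _ => //.
  by apply: L2D; exact: Lsum.
apply: leeD; first exact: L2norm_cut_le.
apply: le_trans (L2norm_cutD _ _) _; [exact: Lsum..|].
rewrite EFinD; apply: leeD.
  apply: le_trans (L2norm_cut_le (Lsum _)) _; rewrite L2normE//.
  under eq_fun do rewrite -big_filter.
  rewrite lee_fin L2dot_sum_sum ?filter_uniq//.
  rewrite -[leRHS]ger0_norm// -sqrtr_sqr ler_wsqrtr// lowS ?filter_uniq//.
  by move=> n; rewrite mem_filter => /andP[].
apply: le_trans (L2norm_cut_sum _ _ _ Le) _.
have highE : (\sum_(n <- s | ~~ (n <= n0)%R) `|c n|%:E * L2norm D (cut (e n))
    <= (\sum_(n <- s | ~~ (n <= n0)) `|c n| * b n)%R%:E)%E.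
  rewrite -sumEFin; apply: lee_sum => n; rewrite -ltNge EFinM => /eb nb.
  exact: lee_wpmul2l.
apply: le_trans highE _.
rewrite lee_fin -sumE (le_trans _ (highT N))//.
by under eq_bigl do rewrite -ltNge.
Qed.

End Restriction.

(** * The abstract stability estimate and the form of its constant *)

Definition tail_constant {R : realType} (al be : R) : R :=
  (1 - expR (- (al - be)))^-1 + (1 - expR (- be))^-1.

(** H_T enters only through the relation between the coefficients of [h] and [f]. The lower bound on
    [sigma] includes [n0], because the value at [n0] controls the whole low block; the decay of the
    cut modes is used strictly beyond [n0]. *)
Lemma truncated_stability {R : realType} (F G E : set R)
    (u v : int -> R -> R) (sigma : int -> R) (al be A B delta M : R) (n0 : nat)
    (f h : R -> R) :
  measurable F -> measurable G -> measurable E ->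
  0 < be -> be < al -> 0 < A -> 0 < B -> 0 < delta -> 0 < M ->
  orthonormal_basis F u -> orthonormal_basis G v ->
  (forall m n, m <= n -> sigma n <= sigma m) -> (forall n, 0 < sigma n) ->
  (forall n : nat, (n0 <= n)%N -> A * expR (- (al * n%:R)) <= sigma n%:Z) ->
  (forall n : nat, (n0 < n)%N ->
     (L2norm F (\1_E \* u n%:Z)%R <= (B * expR (- (be * n%:R)))%R%:E)%E) ->
  L2 F f -> L2 G h ->
  (forall n, L2dot G h (v n) = sigma n * L2dot F f (u n)) ->
  (L2norm G h <= (2 * delta)%R%:E)%E -> (L2norm F f <= (2 * M)%R%:E)%E ->
  (L2norm F (\1_E \* f)%R <=
     (2 * delta * A^-1 * expR (al * n0%:R)
      + 2 * B * (delta / A) `^ (be / al) * M `^ ((al - be) / al)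
        * tail_constant al be)%R%:E)%E.
Proof.
move=> mF mG mE be0 beal A0 B0 d0 M0 bu bv sdecr sgt0 slow ulow.
move=> Lf Lh adj hle fle.
have [Lu u_orth _] := bu; have [Lv v_orth _] := bv.
set c := fun n => L2dot F f (u n).
have dA0 : 0 < delta / A by rewrite divr_gt0.
(* Logarithms turn the two bounds on a coefficient, from the data and from the norm of [f], into the
   exponentials of [sum_min_expR_le]. *)
pose X := ln (delta / A); pose Y := ln M.
have c_le n : (n0 < n)%N ->
    `|c n%:Z| <= 2 * Num.min (expR (X + al * n%:R)) (expR Y).
  move=> n0n; rewrite minr_pMr// le_min; apply/andP; split.
    rewrite expRD lnK ?posrE//.
    have : sigma n%:Z * `|c n%:Z| <= 2 * delta.
      rewrite -(gtr0_norm (sgt0 n)) -normrM -adj -lee_fin.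
      exact: le_trans (normr_L2dot_le mG Lv v_orth _ Lh) hle.
    have s_ge := slow n (ltnW n0n).
    move/(le_trans (ler_wpM2r (normr_ge0 (c n%:Z)) s_ge)).
    rewrite expRN mulrAC ler_pdivrMr ?expR_gt0// mulrC -ler_pdivlMr//.
    move=> /le_trans; apply.
    by rewrite le_eqVlt; apply/orP; left; apply/eqP; field; rewrite gt_eqF.
  rewrite lnK ?posrE// -lee_fin.
  exact: le_trans (normr_L2dot_le mF Lu u_orth _ Lf) fle.
pose b (n : int) := B * expR (- (be * n%:~R)).
apply: (@L2norm_cut_basis_le _ _ _ mF mE u f n0%:Z b) => //.
- by rewrite !mulr_ge0 ?expR_ge0 ?invr_ge0 ?ltW.
- by case=> // n; rewrite ltz_nat /b -pmulrn => /ulow.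
(* For n <= n0 monotonicity gives sigma_n >= t, so t^2 times the sum of the c_n^2 is at most the sum
   of the <h, v_n>^2, hence at most (2 delta)^2 by Bessel. *)
- move=> s us s_le; pose t := A * expR (- (al * n0%:R)).
  have t0 : 0 < t by rewrite mulr_gt0 ?expR_gt0.
  have -> : 2 * delta * A^-1 * expR (al * n0%:R) = 2 * delta / t.
    by rewrite /t expRN; field; rewrite !gt_eqF ?expR_gt0.
  rewrite expr_div_n ler_pdivlMr ?exprn_gt0// big_distrl/=.
  have hh : L2dot G h h <= (2 * delta) ^+ 2.
    move: hle; rewrite L2normE// lee_fin => hle.
    rewrite -(sqr_sqrtr (L2dotxx_ge0 G h)) ler_sqr ?nnegrE ?sqrtr_ge0//.
    by rewrite mulr_ge0// ltW.
  apply: le_trans hh; apply: le_trans (bessel mG Lv v_orth us Lh).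
  rewrite big_seq [leRHS]big_seq; apply: ler_sum => n /s_le n_le.
  rewrite adj [leRHS]exprMn [leRHS]mulrC ler_wpM2l ?sqr_ge0//.
  rewrite ler_sqr ?nnegrE ?(ltW t0) ?(ltW (sgt0 _))//.
  exact: le_trans (slow n0 (leqnn _)) (sdecr _ _ n_le).
- move=> N; set K := N.*2.+1.
  (* The shift is N because position i of the partial sum carries the mode n = i - N. Positions with
     n <= n0 contribute 0 on the left and a nonnegative term on the right. *)
  have sum_le := sum_min_expR_le X Y N%:R K be0 beal.
  have -> : (delta / A) `^ (be / al) = expR (be / al * X).
    by rewrite /powR gt_eqF.
  have -> : M `^ ((al - be) / al) = expR ((al - be) / al * Y).
    by rewrite /powR gt_eqF.
  rewrite -(mulrA (2 * B)) -expRD -(mulrA (2 * B)).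
  apply: le_trans (ler_wpM2l _ sum_le); last by rewrite mulr_ge0 ?ltW.
  rewrite big_mkcond mulr_sumr; apply: ler_sum => i _; case: ifPn => [|_].
    case E1 : (i%:Z - N%:Z) => [n|n]//; rewrite ltz_nat => n0n.
    have nE : n%:R = i%:R - N%:R :> R.
      by rewrite -[n%:R]/(n%:Z%:~R) -E1 rmorphB.
    rewrite /b -[n%:~R]/(n%:R) -nE.
    rewrite [leRHS](_ : _ = 2 * Num.min (expR (X + al * n%:R)) (expR Y)
      * (B * expR (- (be * n%:R)))); last by ring.
    by rewrite ler_wpM2r ?c_le// mulr_ge0 ?expR_ge0 ?ltW.
  by rewrite !mulr_ge0 ?expR_ge0 ?(ltW B0)// le_min !expR_ge0.
Qed.

(* The solution of the equation [tail_bound_absorbed] for this constant. *)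
Definition absorbing_constant {R : realType} (al be c : R) (N : nat) : R :=
  expR (- (al / be) * ln (tail_constant al be * N%:R * c `^ (- (be / al))
                          * (al - be) * (expR be - 1) / al)).

(** The constant appears to the power - be / al, which returns the argument [Y] of its logarithm.
    [Y] supplies [tail_constant] and cancels 1 / N and the last fraction; its power of [c] turns the
    factor c into c^((al - be) / al). *)
Lemma tail_bound_absorbed {R : realType} (al be c A B delta kappa : R)
    (N : nat) :
  0 < be -> be < al -> 0 < c -> (0 < N)%N -> 0 < A -> 0 < delta -> 0 < kappa ->
  2 * B * (delta / A) `^ (be / al) * (kappa * c) `^ ((al - be) / al)
    * tail_constant al be =
  2 * c / N%:R * B * kappa `^ ((al - be) / al)
    * (delta / (A * absorbing_constant al be c N)) `^ (be / al)
    * (al / ((al - be) * (expR be - 1))).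
Proof.
move=> be0 beal c0 N0 A0 d0 k0.
have al0 : 0 < al by exact: lt_trans beal.
have e1 : 0 < expR be - 1 by rewrite subr_gt0 -expR0 ltr_expR.
have e2 : 0 < 1 - expR (- be) by rewrite subr_gt0 -expR0 ltr_expR oppr_lt0.
have e3 : 0 < 1 - expR (- (al - be)).
  by rewrite subr_gt0 -expR0 ltr_expR oppr_lt0 subr_gt0.
have NR : 0 < N%:R :> R by rewrite ltr0n.
have C0 : 0 < tail_constant al be by rewrite addr_gt0 ?invr_gt0.
rewrite /absorbing_constant; set Y := (X in ln X).
have ab0 : 0 < al - be by rewrite subr_gt0.
have Y0 : 0 < Y by rewrite divr_gt0// !mulr_gt0// powR_gt0.
have -> : delta / (A * expR (- (al / be) * ln Y)) =
    delta / A * expR (al / be * ln Y).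
  by rewrite invfM mulrA -expRN mulNr opprK.
rewrite !powRM ?expR_ge0 ?divr_ge0 ?invr_ge0 ?(ltW d0) ?(ltW A0) ?(ltW k0)
  ?(ltW c0)//.
have -> : expR (al / be * ln Y) `^ (be / al) = Y.
  rewrite /powR gt_eqF ?expR_gt0// expRK.
  have -> : be / al * (al / be * ln Y) = ln Y by field; rewrite !gt_eqF.
  by rewrite lnK.
have -> : c `^ ((al - be) / al) = c * c `^ (- (be / al)).
  have -> : (al - be) / al = 1 + - (be / al) by field; rewrite gt_eqF.
  rewrite powRD; first by rewrite powRr1 ?(ltW c0).
  by rewrite (gt_eqF c0) implybT.
by rewrite /Y; field; rewrite !gt_eqF.
Qed.

(** * Stability for two admissible solutions *)

Section Admissible.
Context {R : realType}.
Variables (a1 a2 a3 a4 : R).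
Hypotheses (a12 : a1 < a2) (a23 : a2 < a3) (a34 : a3 < a4).

Lemma L2norm_bounded_le (k : R) (f : R -> R) : 0 <= k -> L2 `]a2, a4[ f ->
  (forall x, a2 < x -> x < a4 -> `|f x| <= k) ->
  (L2norm `]a2, a4[ f <= (k * Num.sqrt (a4 - a2))%R%:E)%E.
Proof.
move=> k0 Lf fk; have mF : measurable (`]a2, a4[ : set R) by [].
rewrite L2normE// lee_fin -[X in X * _]ger0_norm// -sqrtr_sqr.
rewrite -sqrtrM ?sqr_ge0//.
apply: ler_wsqrtr.
have a24 : a2 < a4 by exact: lt_trans a34.
have muF : lebesgue_measure (`]a2, a4[ : set R) = (a4 - a2)%:E.
  by rewrite lebesgue_measure_itv/= lte_fin a24.
have -> : k ^+ 2 * (a4 - a2) = \int[lebesgue_measure]_(x in `]a2, a4[) (k ^+ 2).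
  by rewrite Rintegral_cst// [X in fine X]muF.
apply: le_Rintegral => //; first exact: L2_integrableM.
- apply/integrableP; split; first exact: measurable_cst.
  under eq_integral do rewrite /=.
  by rewrite integral_cst// [X in (_ * X)%E]muF -EFinM ltry.
- move=> x; rewrite /= in_itv/= => /andP[x2 x4].
  by rewrite -expr2 -real_normK ?num_real// ler_sqr ?nnegrE// fk.
Qed.

(** Makes the reconstruction error a difference of two admissible solutions, and guarantees that the
    algorithm has a solution to find. *)
Lemma admissible_exact (kappa delta : R) (f_ex g_ex g : R -> R) :
  exact_data a1 a2 a3 a4 kappa f_ex g_ex -> noisy_data a1 a3 delta g_ex g ->
  admissible a1 a2 a3 a4 delta kappa g f_ex.
Proof.
move=> [Hfg TVf vf] [Lg gd]; split => //.
- by rewrite /BV_oo (le_lt_trans TVf) ?ltry.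
- by exists g_ex => //; rewrite L2normC.
Qed.

(** Instance of [truncated_stability] for the differences f_a - f_b and h_a - h_b, with M = kappa *
    sqrt(a4 - a2). *)
Lemma chi_norm_sub_le (u v : int -> R -> R) (sigma : int -> R)
    (al be m A B kappa delta : R) (N : nat) (f_a f_b g : R -> R) :
  singular_system `]a2, a4[ `]a1, a3[ u v sigma ->
  0 < be -> be < al -> 0 < A -> 0 < B -> 0 < kappa -> 0 < delta ->
  (forall n : int, 0 < sigma n) ->
  (forall n : nat, (N <= n)%N -> A * expR (- (al * n%:R)) <= sigma n%:Z) ->
  (forall n : nat, (N < n)%N ->
     (chi_norm a2 a3 a4 m (u n%:Z) <= (B * expR (- (be * n%:R)))%R%:E)%E) ->
  L2 `]a1, a3[ g ->
  admissible a1 a2 a3 a4 delta kappa g f_a ->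
  admissible a1 a2 a3 a4 delta kappa g f_b ->
  (chi_norm a2 a3 a4 m (f_a \- f_b)%R <=
     (2 * delta * A^-1 * expR (al * N%:R)
      + 2 * B * (delta / A) `^ (be / al)
        * (kappa * Num.sqrt (a4 - a2)) `^ ((al - be) / al)
        * tail_constant al be)%R%:E)%E.
Proof.
move=> [bu bv _ adj sdecr _ _] be0 beal A0 B0 k0 d0 sgt0 slow ulow Lg.
move=> [_ [h_a Ha ha_le] TVa [va _]] [_ [h_b Hb hb_le] TVb [vb _]].
have [Lfa Lha _] := Ha; have [Lfb Lhb _] := Hb.
have mG : measurable (`]a1, a3[ : set R) by [].
have mF : measurable (`]a2, a4[ : set R) by [].
have bnd f x : (TV_oo a2 a4 f <= kappa%:E)%E ->
    f y @[y --> a2^'+] --> (0 : R) ->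
    a2 < x -> x < a4 -> `|f x| <= kappa by exact: normr_le_TV_oo.
apply: (truncated_stability mF mG _ be0 beal A0 B0 d0 _ bu bv
         (f := f_a \- f_b) (h := h_a \- h_b)) => //.
- by rewrite mulr_gt0// sqrtr_gt0 subr_gt0 (lt_trans a23).
- exact: sdecr.
- exact: L2B.
- exact: L2B.
- move=> n; have [Lu _ _] := bu; have [Lv _ _] := bv.
  have adjL f h : is_HT `]a2, a4[ `]a1, a3[ f h ->
      L2dot `]a1, a3[ h (v n) = sigma n * L2dot `]a2, a4[ f (u n).
    move=> Hf; have [Lf _ _] := Hf; rewrite (adj n _ _ Hf).
    rewrite /L2dot; under eq_Rintegral do rewrite mulrCA.
    by rewrite RintegralZl//; exact: L2_integrableM.
  by rewrite !L2dotBl// (adjL _ _ Ha) (adjL _ _ Hb) mulrBr.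
(* Both images lie within delta of [g], so passing through [g] costs 2 delta. *)
- have -> : h_a \- h_b = (fun x => (h_a \- g) x + (g \- h_b) x).
    by apply/funext => x /=; rewrite addrA subrK.
  apply: le_trans (L2normD _ _) _ => //; [exact: L2B|exact: L2B|].
  by rewrite mulr2n mulrDl mul1r EFinD leeD// L2normC.
- rewrite mulrA; apply: L2norm_bounded_le.
  + by rewrite mulr_ge0 ?ltW.
  + exact: L2B.
  + move=> x x2 x4; rewrite /= (le_trans (ler_normB _ _))//.
    by rewrite mulr2n mulrDl mul1r lerD// bnd.
Qed.

End Admissible.

(** * Vanishing of the bound as delta tends to 0, and the final statement *)

Lemma stability_bound_cvg0 {R : realType} (p q r th : R) : 0 < th -> 0 <= r ->
  p * d + q * (d * r) `^ th @[d --> 0^'+] --> (0 : R).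
Proof.
move=> th0 r0.
have lim : p * d + q * (d `^ th * r `^ th) @[d --> 0^'+]
    --> p * 0 + q * (0 * r `^ th).
  apply: cvgD; apply: cvgM; try exact: cvg_cst.
    by apply: cvg_at_right_filter; exact: cvg_id.
  by apply: cvgM; [exact: powR_cvg0|exact: cvg_cst].
rewrite mul0r !mulr0 addr0 in lim.
apply: cvg_trans lim; apply: near_eq_cvg; near=> d.
rewrite powRM//.
Unshelve. all: by end_near. Qed.

Theorem proposition2 (R : realType) :
  exists2 W : R -> R -> R -> nat -> R,
    (forall (al be c : R) (N : nat), 0 < W al be c N) &
  forall a1 a2 a3 a4 : R, a1 < a2 -> a2 < a3 -> a3 < a4 ->
  exists2 c : R, 0 < c &
  forall A : R, 0 < A -> A < 2 ->
  exists N0min : nat,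
  forall (mu : R) (N0 Nmu : nat) (B : R),
    let al := alpha a1 a2 a3 a4 in
    let be := beta a1 a2 a3 a4 mu in
    0 < mu -> mu < a3 - a2 ->
    (N0min <= N0)%N -> (N0 < Nmu)%N -> 0 < B ->
  forall kappa : R, 0 < kappa ->
  exists2 delta0 : R, 0 < delta0 &
  forall (u v : int -> R -> R) (sigma : int -> R),
    singular_system `]a2, a4[ `]a1, a3[ u v sigma ->
    sigma_asymptotics al sigma ->
    (forall n : int, 0 < sigma n /\ sigma n < 1) ->
    (forall n : nat, (N0 < n)%N -> A * expR (- (al * n%:R)) <= sigma n%:Z) ->
    (forall n : nat, (Nmu < n)%N ->
       (chi_norm a2 a3 a4 mu (u n%:Z) <= (B * expR (- (be * n%:R)))%R%:E)%E) ->
  (forall algo : R -> R -> (R -> R) -> (R -> R),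
     computes_admissible a1 a2 a3 a4 kappa algo ->
     regularization_method a1 a2 a3 a4 mu kappa algo) /\
  (forall (f_ex g_ex g : R -> R) (delta : R),
     0 < delta -> delta <= delta0 ->
     exact_data a1 a2 a3 a4 kappa f_ex g_ex ->
     noisy_data a1 a3 delta g_ex g ->
   forall f_a f_b : R -> R,
     admissible a1 a2 a3 a4 delta kappa g f_a ->
     admissible a1 a2 a3 a4 delta kappa g f_b ->
     (chi_norm a2 a3 a4 mu (f_a \- f_b)%R <=
      (2 * delta * A^-1 * expR (al * Nmu%:R)
       + 2 * c / Nmu%:R * B * kappa `^ ((al - be) / al)
         * (delta / (A * W al be c Nmu)) `^ (be / al)
         * (al / ((al - be) * (expR be - 1))))%R%:E)%E).
Proof.
exists absorbing_constant => [al be c N|a1 a2 a3 a4 a12 a23 a34].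
  exact: expR_gt0.
have c0 : 0 < Num.sqrt (a4 - a2).
  by rewrite sqrtr_gt0 subr_gt0 (lt_trans a23).
exists (Num.sqrt (a4 - a2)) => // A A0 _.
exists 0%N => m N0 N B al be m0 ma _ N0N B0 kappa k0.
(* The estimate below is proved for every positive [delta], so 1 serves as threshold. *)
exists 1 => // u v sigma ss _ s01 slow ulow.
have al0 : 0 < al := rate_gt0 A0 (ss_lim0 ss) slow.
have [be0 beal] := alpha_beta_bounds a12 a34 al0 m0 ma.
have N_gt0 : (0 < N)%N by exact: leq_ltn_trans N0N.
have estimate delta g f_a f_b : 0 < delta -> L2 `]a1, a3[ g ->
    admissible a1 a2 a3 a4 delta kappa g f_a ->
    admissible a1 a2 a3 a4 delta kappa g f_b ->
    (chi_norm a2 a3 a4 m (f_a \- f_b)%R <=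
      (2 * delta * A^-1 * expR (al * N%:R)
       + 2 * B * (delta / A) `^ (be / al)
         * (kappa * Num.sqrt (a4 - a2)) `^ ((al - be) / al)
         * tail_constant al be)%R%:E)%E.
  move=> d0 Lg; apply: (chi_norm_sub_le a23 a34 ss) => //.
  - by move=> n; have [] := s01 n.
  (* The strict inequality N0 < N makes the lower bound on [sigma] available at n = N itself. *)
  - by move=> n Nn; apply: slow; exact: leq_trans Nn.
split=> [algo algoP f_ex g_ex Hex eps eps0|]; last first.
  move=> f_ex g_ex g delta d0 _ _ [Lg _] f_a f_b Ha Hb.
  by rewrite -tail_bound_absorbed//; exact: estimate Ha Hb.
have th0 : 0 < be / al by rewrite divr_gt0.
have A_ge0 : 0 <= A^-1 by rewrite invr_ge0 ltW.
have bound0 := stability_bound_cvg0 (2 * A^-1 * expR (al * N%:R))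
  (2 * B * (kappa * Num.sqrt (a4 - a2)) `^ ((al - be) / al)
   * tail_constant al be) th0 A_ge0.
(* The bound depends on delta but not on [g], so one choice of small delta works for all noisy
   data. *)
near=> delta => g Hg.
have d0 : 0 < delta by near: delta; exact: nbhs_right_gt.
have Hadm := admissible_exact Hex Hg; have [Lg _] := Hg.
apply: le_trans (estimate _ _ _ _ d0 Lg _ Hadm) _.
  by apply: algoP => //; exists f_ex.
rewrite lee_fin; set lhs := (X in X <= _).
have -> : lhs = 2 * A^-1 * expR (al * N%:R) * delta
    + 2 * B * (kappa * Num.sqrt (a4 - a2)) `^ ((al - be) / al)
      * tail_constant al be * (delta * A^-1) `^ (be / al).
  by rewrite /lhs; ring.
by near: delta; exact: (cvgr_le 0 bound0).
Unshelve. all: by end_near. Qed.
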